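(* Let $n\in\mathbb N$ and consider on $\mathbb M_n=\{L=D^n+u_{n-1}D^{n-1}+\dots+u_0\}$ the Poisson bracket $$\{\varphi,\psi\}=\left\langle\left\langle\begin{pmatrix} r+\frac12\frac{1+\hat h^n}{1-\hat h^n}P_0' & -\frac{\hat h^n}{1-\hat h^n}P_0'+\frac12P_{00}\\[4pt] \frac{1}{1-\hat h^n}P_0'+\frac12P_{00} & r-\frac12\frac{1+\hat h^n}{1-\hat h^n}P_0'\end{pmatrix}\begin{pmatrix}\nabla\varphi\\ \nabla'\varphi\end{pmatrix},\begin{pmatrix}\nabla\psi\\ \nabla'\psi\end{pmatrix}\right\rangle\right\rangle,\qquad r=\tfrac12(P_+-P_-).$$ In terms of the generating functions $u_i(z)=\sum_{m=-\infty}^{N(u_i)}u_{im}z^m$, $i=0,\dots,n-1$, this bracket has the form $$\{u_i(z),u_j(w)\}=\sum_{m\in\mathbb Z,\,m\ne0}\frac{(1-q^{m(n-i)})(1-q^{mj})}{1-q^{mn}}\left(\frac wz\right)^mu_i(z)u_j(w)$$ $$+\sum_{r=1}^{\min(n-i,j)}\delta\!\left(\frac{wq^r}{z}\right)u_{i+r}(w)u_{j-r}(z)-\sum_{r=1}^{\min(n-i,j)}\delta\!\left(\frac{w}{zq^{i-j+r}}\right)u_{i+r}(z)u_{j-r}(w),$$ where $\delta(z)=\sum_{m\in\mathbb Z}z^m$. Thus this bracket coincides with the one constructed by Frenkel and Reshetikhin (the bracket given by this formula).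
   Context: Fix $q\in\mathbb C$, $0<|q|<1$. $\mathbb C((z^{-1}))$ is the field of formal series $\sum_{i\le N}a_iz^i$; $(\hat hf)(z)=f(qz)$. $\Psi\mathbf D_q$ is the algebra of formal series $\sum_{i=-\infty}^{N}a_iD^i$, $a_i\in\mathbb C((z^{-1}))$, with $D a=(\hat ha)D$. $P_+,P_0,P_-$ are the projections onto the parts with positive, zero, negative powers of $D$; $\int a\,dz/z$ is the coefficient of $z^0$ of $a$; $\operatorname{Tr}A=\int P_0A\,dz/z$; $\langle A,B\rangle=\operatorname{Tr}AB$; $P_{00}A=\operatorname{Tr}(A)\cdot1$, $P_0'=P_0-P_{00}$; $\langle\langle(X_1,X_2),(Y_1,Y_2)\rangle\rangle=\langle X_1,Y_1\rangle-\langle X_2,Y_2\rangle$. For a functional $\varphi$ of $L\in\mathbb M_n$, $d\varphi(L)\in\Psi\mathbf D_q$ is any element with $\langle d\varphi(L),X\rangle=\frac d{dt}|_{t=0}\varphi(L+tX)$ for $X$ tangent to $\mathbb M_n$ (the bracket does not depend on the choice); $\nabla\varphi=L\,d\varphi$, $\nabla'\varphi=d\varphi\,L$. The coefficients $u_{im}$ are regarded as functionals on $\mathbb M_n$, and $\{u_i(z),u_j(w)\}$ denotes the formal series $\sum_{k,l}\{u_{ik},u_{jl}\}z^kw^l$. The convention $u_n=1$ is used in the right-hand side. The index $r$ in the last two sums is a summation index (not the operator $r$). *)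

(* Defs.v *)
From HB Require Import structures.
From mathcomp Require Import all_boot all_order all_algebra.
From mathcomp Require Import zify.
From mathcomp Require Import boolp classical_sets functions cardinality fsbigop.
From mathcomp Require Import topology normedtype derive.

Set Implicit Arguments.
Unset Strict Implicit.
Unset Printing Implicit Defensive.

Import Order.TTheory GRing.Theory Num.Theory.
Import numFieldNormedType.Exports.

Local Open Scope classical_set_scope.
Local Open Scope ring_scope.

(* A formal series \sum_(i <= N) a_i t^i in t^-1 is its family of coefficients
   a : int -> V, required to vanish for all large indices.  The case V = K,
   t = z gives K((z^-1)); the case V = K((z^-1)), t = D gives the q-difference
   pseudodifferential symbols. *)
Section Series.
Variables (K : nzRingType) (V : lmodType K).

Definition bounded_above : {pred int -> V} :=
  fun f => `[< exists N : int, forall i, N < i -> f i = 0 >].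

Lemma bounded_aboveP (f : int -> V) :
  reflect (exists N : int, forall i, N < i -> f i = 0) (f \in bounded_above).
Proof. exact: asboolP. Qed.

Record series := Series {
  coefs :> int -> V;
  coefs_bounded : coefs \in bounded_above }.

HB.instance Definition _ := [isSub for coefs].
HB.instance Definition _ := [Choice of series by <:].

Lemma bounded_above_submod : submod_closed bounded_above.
Proof.
split; first by apply/bounded_aboveP; exists 0.
move=> c f g /bounded_aboveP[N Nf] /bounded_aboveP[M Mg].
apply/bounded_aboveP; exists (Num.max N M) => i; rewrite gt_max => /andP[Ni Mi].
have -> : (c *: f + g) i = c *: f i + g i by [].
by rewrite Nf// Mg// scaler0 addr0.
Qed.

HB.instance Definition _ :=
  GRing.isSubmodClosed.Build K (int -> V) bounded_above bounded_above_submod.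
HB.instance Definition _ := [SubChoice_isSubLmodule of series by <:].

Lemma series_bound (a : series) : exists N : int, forall i, N < i -> a i = 0.
Proof. exact/bounded_aboveP/coefs_bounded. Qed.

Lemma seriesP (a b : series) : (forall i, a i = b i) -> a = b.
Proof. by move=> ab; apply/val_inj/funext. Qed.

Lemma coefsD (a b : series) i : (a + b) i = a i + b i. Proof. by []. Qed.
Lemma coefsN (a : series) i : (- a) i = - a i. Proof. by []. Qed.
Lemma coefs0 i : (0 : series) i = 0. Proof. by []. Qed.
Lemma coefsZ c (a : series) i : (c *: a) i = c *: a i. Proof. by []. Qed.

Lemma monomial_bounded (v : V) (e : int) :
  (fun k => if k == e then v else 0) \in bounded_above.
Proof.
by apply/bounded_aboveP; exists e => i; case: eqP => // ->; rewrite ltxx.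
Qed.
Definition monomial v e : series := Series (monomial_bounded v e).

Lemma part_bounded (P : pred int) (a : series) :
  (fun k => if P k then a k else 0) \in bounded_above.
Proof.
have [N Na] := series_bound a.
by apply/bounded_aboveP; exists N => i /Na ->; case: ifP.
Qed.
Definition part P a : series := Series (part_bounded P a).

End Series.

Section Laurent.
Variable K : numFieldType.

(* K((z^-1)) *)
Definition laurent := series K^o.

HB.instance Definition _ := GRing.Lmodule.copy laurent (series K^o).

Implicit Types (a b c : laurent).

Lemma lmul_bounded a b :
  (fun k => \sum_(i \in [set: int]) a i * b (k - i)) \in bounded_above (V := K^o).
Proof.
have [N Na] := series_bound a; have [M Mb] := series_bound b.
apply/bounded_aboveP; exists (N + M) => k NMk.
apply: fsbig1 => i _; have [/Na ->|iN] := ltP N i; first by rewrite mul0r.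
by rewrite Mb ?mulr0//; lia.
Qed.
Definition lmul a b : laurent := Series (lmul_bounded a b).
Definition lone : laurent := monomial (1 : K^o) 0.

Lemma lmulE a b (N M : int) (t : nat) :
  (forall i, N < i -> a i = 0) -> (forall i, M < i -> b i = 0) ->
  lmul a b (N + M - t%:Z) =
  \sum_(i < t.+1) a (N - i%:Z) * b (M - (t - i)%N%:Z) :> K.
Proof.
move=> Na Mb; rewrite /lmul/=; set k := N + M - t%:Z.
pose I := [seq N - i%:Z | i <- iota 0 t.+1].
have supp i : (a i : K) * b (k - i) != 0 -> i \in I.
  have [/Na ->|iN] := ltP N i; first by rewrite mul0r eqxx.
  have [/Mb ->|iM] := ltP M (k - i); first by rewrite mulr0 eqxx.
  by move=> _; apply/mapP; exists `|N - i|%N; rewrite ?mem_iota; lia.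
rewrite -(@fsbig_widen _ _ _ _ [set` I])//; last first.
  move=> i [_ iI]; apply/eqP; apply: contra_notT iI; exact: supp.
rewrite -fsbig_seq; last by rewrite map_inj_uniq ?iota_uniq// => i j; lia.
rewrite big_map -[t.+1 in LHS]subn0 -/(index_iota _ _) big_mkord.
by apply: eq_bigr => i _; congr (a _ * b _); have := ltn_ord i; rewrite /k; lia.
Qed.

Lemma lmul_coef a b (N M : int) (t T : nat) : (t < T)%N ->
  (forall i, N < i -> a i = 0) -> (forall i, M < i -> b i = 0) ->
  lmul a b (N + M - t%:Z) =
  ((\poly_(i < T) (a (N - i%:Z) : K)) * \poly_(i < T) (b (M - i%:Z) : K))`_t.
Proof.
move=> tT Na Mb; rewrite lmulE// coefM; apply: eq_bigr => i _.
rewrite !coef_poly (leq_trans (ltn_ord i)) ?ltnS//.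
by rewrite (leq_ltn_trans (leq_subr _ _)).
Qed.

Lemma series_bound_ge a (m : int) :
  exists2 N : int, m <= N & forall i, N < i -> a i = 0.
Proof.
have [N Na] := series_bound a; exists (Num.max m N); first by rewrite le_max lexx.
by move=> i; rewrite gt_max => /andP[_ /Na].
Qed.

Lemma lmulC : commutative lmul.
Proof.
move=> a b; apply: seriesP => k.
have [N kN Na] := series_bound_ge a k; have [M M0 Mb] := series_bound_ge b 0.
set t := `|(N + M - k)%R|%N.
have -> : k = N + M - t%:Z by lia.
rewrite (lmul_coef (ltnSn t) Na Mb) [in RHS](addrC N M).
by rewrite (lmul_coef (ltnSn t) Mb Na) mulrC.
Qed.

Lemma lmul_bound a b (N M : int) :
  (forall i, N < i -> a i = 0) -> (forall i, M < i -> b i = 0) ->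
  forall k, N + M < k -> lmul a b k = 0.
Proof.
move=> Na Mb k NMk; apply: fsbig1 => i _.
by have [/Na ->|iN] := ltP N i; rewrite ?mul0r// Mb ?mulr0//; lia.
Qed.

Lemma lmulA : associative lmul.
Proof.
move=> a b c; apply: seriesP => k.
have [N kN Na] := series_bound_ge a k; have [M M0 Mb] := series_bound_ge b 0.
have [P P0 Pc] := series_bound_ge c 0.
set t := `|(N + M + P - k)%R|%N.
have kE : k = N + (M + P) - t%:Z by lia.
rewrite kE (lmul_coef (ltnSn t) Na (lmul_bound Mb Pc)).
rewrite addrA (lmul_coef (ltnSn t) (lmul_bound Na Mb) Pc).
set p := \poly_(i < t.+1) (a (N - i%:Z) : K).
set r := \poly_(i < t.+1) (b (M - i%:Z) : K).
set s := \poly_(i < t.+1) (c (P - i%:Z) : K).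
transitivity ((p * (r * s))`_t).
  rewrite !coefM; apply: eq_bigr => i _; congr (_ * _).
  have it : (t - i < t.+1)%N by rewrite ltnS leq_subr.
  by rewrite coef_poly it (lmul_coef it).
rewrite mulrA !coefM; apply: eq_bigr => i _; congr (_ * _).
by rewrite coef_poly ltn_ord (lmul_coef (ltn_ord i)).
Qed.

Lemma lmul1 : left_id lone lmul.
Proof.
move=> a; apply: seriesP => k; rewrite /lmul/=.
rewrite -(@fsbig_widen _ _ _ _ [set 0])//.
  by rewrite fsbig_set1/= mul1r subr0.
by move=> i [_ /eqP /negPf/= ->]; rewrite mul0r.
Qed.

Lemma lmulDl : left_distributive lmul +%R.
Proof.
move=> a b c; apply: seriesP => k.
have [N kN Na] := series_bound_ge a k; have [M kM Mb] := series_bound_ge b k.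
have [P P0 Pc] := series_bound_ge c 0.
have Na' i : Num.max N M < i -> a i = 0 by rewrite gt_max => /andP[/Na].
have Mb' i : Num.max N M < i -> b i = 0 by rewrite gt_max => /andP[_ /Mb].
have Nab i : Num.max N M < i -> (a + b) i = 0.
  by move=> iN; rewrite coefsD Na'// Mb'// addr0.
have kE : k = Num.max N M + P - `|(Num.max N M + P - k)%R|%N%:Z.
  by have : k <= Num.max N M; [rewrite le_max kN | lia].
rewrite coefsD kE !lmulE// -big_split; apply: eq_bigr => i _ /=.
exact: mulrDl.
Qed.

Lemma lone_neq0 : lone != 0.
Proof.
apply/eqP => /(congr1 (fun a : laurent => a 0)) /eqP.
by rewrite /= oner_eq0.
Qed.

HB.instance Definition _ := GRing.Zmodule_isComNzRing.Build laurent
  lmulA lmulC lmul1 lmulDl lone_neq0.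

Lemma lcoefsM a b k :
  (a * b) k = \sum_(i \in [set: int]) (a i : K) * (b (k - i) : K).
Proof. by []. Qed.

(* \int a dz/z *)
Definition lint a : K := a 0.

End Laurent.

Section QDifference.
Variables (K : numFieldType) (q : K).

Implicit Types (a : laurent K) (n e : int).

Lemma hpow_bounded e a :
  (fun m => q ^ (e * m) * (a m : K)) \in bounded_above (V := K^o).
Proof.
have [N Na] := series_bound a.
by apply/bounded_aboveP; exists N => i /Na ->; rewrite mulr0.
Qed.

(* (h^e a)(z) = a (q^e z), for an exponent e of any sign *)
Definition hpow e a : laurent K := Series (hpow_bounded e a).

Lemma hinv_bounded n a :
  (fun m => if m == 0 then 0 else (1 - q ^ (n * m))^-1 * (a m : K))
    \in bounded_above (V := K^o).
Proof.
have [N Na] := series_bound a.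
apply/bounded_aboveP; exists N => i /Na ->.
by rewrite mulr0; case: ifP.
Qed.

(* (1 - h^n)^-1, on the series without constant term; see hinvK and hinv0 *)
Definition hinv n a : laurent K := Series (hinv_bounded n a).

Lemma hinv0 n a : lint (hinv n a) = 0.
Proof. by []. Qed.

Lemma hinvK n a : (forall m : int, m != 0 -> q ^ (n * m) != 1) ->
  lint a = 0 -> hinv n a - hpow n (hinv n a) = a.
Proof.
move=> qn a0; apply: seriesP => m; rewrite coefsD coefsN /=.
case: eqP => [->|/eqP m0]; first by rewrite mulr0 subr0; exact: esym.
rewrite -[X in X - _]mul1r -mulrBl mulrA divff ?mul1r//.
by rewrite subr_eq0 eq_sym qn.
Qed.

(* The symbols \sum_(i <= N) a_i D^i, with a_i : laurent K *)
Definition psido := series (laurent K).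

HB.instance Definition _ := GRing.Lmodule.copy psido (series (laurent K)).

Implicit Types (A B X Y : psido).

Lemma psmul_bounded A B :
  (fun k => \sum_(i \in [set: int]) A i * hpow i (B (k - i)))
    \in bounded_above (V := laurent K).
Proof.
have [N NA] := series_bound A; have [M MB] := series_bound B.
apply/bounded_aboveP; exists (N + M) => k NMk.
apply: fsbig1 => i _; have [/NA ->|iN] := ltP N i; first by rewrite mul0r.
rewrite MB; last by lia.
have -> : hpow i 0 = 0 by apply: seriesP => m; rewrite /= mulr0.
by rewrite mulr0.
Qed.

(* The product determined by D^i a = (h^i a) D^i *)
Definition psmul A B : psido := Series (psmul_bounded A B).

(* a D^0 *)
Definition of_laurent a : psido := monomial a 0.

Definition Ppos A : psido := part (fun k => 0 < k) A.
Definition Pneg A : psido := part (fun k => k < 0) A.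

(* The subalgebra of symbols a D^0 being identified with laurent K, the
   projections P0, P00 and P0' take their values in the latter. *)
Definition P0 A : laurent K := A 0.
Definition Tr A : K := lint (P0 A).
Definition P00 A : laurent K := Tr A *: (1 : laurent K).
Definition P0' A : laurent K := P0 A - P00 A.

Definition pairing A B : K := Tr (psmul A B).

Definition dpairing (X Y : psido * psido) : K :=
  pairing X.1 Y.1 - pairing X.2 Y.2.

Definition rop A : psido := 2^-1 *: (Ppos A - Pneg A).

(* (1 + h^n) / (1 - h^n), on the series without constant term *)
Definition hcayley n a : laurent K := hinv n a + hpow n (hinv n a).

(* The matrix of operators of the bracket, applied to a column X *)
Definition Rmatrix n (X : psido * psido) : psido * psido :=
  (rop X.1 + of_laurent (2^-1 *: hcayley n (P0' X.1))
     + of_laurent (- hpow n (hinv n (P0' X.2)) + 2^-1 *: P00 X.2),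
   of_laurent (hinv n (P0' X.1) + 2^-1 *: P00 X.1)
     + (rop X.2 - of_laurent (2^-1 *: hcayley n (P0' X.2)))).

End QDifference.

Section Bracket.
Variables (K : numFieldType) (q : K) (n : nat).

(* L = D^n + u_(n-1) D^(n-1) + ... + u_0 *)
Definition is_Mn (L : psido K) : Prop :=
  L n%:Z = 1 /\ forall i : int, i < 0 \/ n%:Z < i -> L i = 0.

Definition tangent_Mn (X : psido K) : Prop :=
  forall i : int, i < 0 \/ n%:Z <= i -> X i = 0.

(* G is a choice of d phi (L).  Only the values of phi on M_n matter. *)
Definition is_gradient (phi : psido K -> K) (L G : psido K) : Prop :=
  forall X, tangent_Mn X ->
    is_derive (0 : K) 1 (fun t : K => phi (L + t *: X)) (pairing q G X).

(* The bracket of phi and psi at L, computed from the choices dphi and dpsi *)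
Definition bracket_of_gradients (L dphi dpsi : psido K) : K :=
  dpairing q (Rmatrix q n%:Z (psmul q L dphi, psmul q dphi L))
             (psmul q L dpsi, psmul q dpsi L).

(* {phi, psi}(L) = c: both gradients exist, and c is the value obtained from
   any choice of them *)
Definition is_bracket (phi psi : psido K -> K) (L : psido K) (c : K) : Prop :=
  [/\ exists dphi, is_gradient phi L dphi,
      exists dpsi, is_gradient psi L dpsi &
      forall dphi dpsi, is_gradient phi L dphi -> is_gradient psi L dpsi ->
        bracket_of_gradients L dphi dpsi = c].

(* The functional u_(im); it makes sense for i = n too, where u_n = 1 on M_n *)
Definition ucoef (i : nat) (m : int) (L : psido K) : K := L i%:Z m.

End Bracket.

(* A formal series in z^(+-1), w^(+-1) is the family of the coefficients of
   z^k w^l. *)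
Section TwoVariables.
Variable K : numFieldType.

Definition series2 := int -> int -> K.

(* a(z) b(w) *)
Definition lprod (a b : laurent K) : series2 := fun k l => (a k : K) * (b l : K).

(* (\sum_(m in Z) c_m (w / z)^m) F(z, w).  For F = lprod a b the sum giving
   each coefficient has finite support. *)
Definition wz_mul (c : int -> K) (F : series2) : series2 :=
  fun k l => \sum_(m \in [set: int]) c m * F (k + m) (l - m).

(* delta(x w / z) F(z, w), with delta(y) = \sum_(m in Z) y^m *)
Definition delta_mul (x : K) (F : series2) : series2 :=
  wz_mul (fun m => x ^ m) F.

(* The right-hand side of the Frenkel-Reshetikhin formula for
   {u_i(z), u_j(w)}, evaluated at L *)
Definition FR_series (q : K) (n : nat) (L : psido K) (i j : nat) : series2 :=
  fun k l =>
    wz_mul (fun m => if m == 0 then 0 else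
        (1 - q ^ (m * (n%:Z - i%:Z))) * (1 - q ^ (m * j%:Z))
          / (1 - q ^ (m * n%:Z)))
      (lprod (L i%:Z) (L j%:Z)) k l
    + \sum_(1 <= r < (minn (n - i) j).+1)
        delta_mul (q ^ r%:Z) (lprod (L (j - r)%N%:Z) (L (i + r)%N%:Z)) k l
    - \sum_(1 <= r < (minn (n - i) j).+1)
        delta_mul (q ^ (i%:Z - j%:Z + r%:Z))^-1
          (lprod (L (i + r)%N%:Z) (L (j - r)%N%:Z)) k l.

End TwoVariables.

(* Main.v *)
Require Import Defs.
From HB Require Import structures.
From mathcomp Require Import all_boot all_order all_algebra complex.
From mathcomp Require Import zify ring.
From mathcomp Require Import boolp classical_sets fsbigop.
From mathcomp Require Import reals normedtype derive.
Import Order.TTheory GRing.Theory Num.Theory.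
Import numFieldNormedType.Exports.
Local Open Scope ring_scope.

Set Implicit Arguments.
Unset Strict Implicit.
Unset Printing Implicit Defensive.

(** Why the formula holds.

    Write X and Y for gradients of phi and psi at L, and A = L X, B = X L.
    Since r = P_+ + P_0 / 2 - 1 / 2 and (1 + h^n) / (1 - h^n) =
    2 / (1 - h^n) - 1, the matrix of the bracket sends (A, B) to
        (A_+ + M - A / 2, B_+ + M - B / 2)
    with one and the same diagonal term M in both entries, namely
        M = (1 - h^n)^-1 P_0' A - h^n (1 - h^n)^-1 P_0' B + P_00 (A + B) / 2
    (Rmatrix_split).  The terms A / 2 and B / 2 cancel, because A L = L B, and
    invariance of the trace turns the bracket into
        {phi, psi} = < V(X), Y >,  V(X) = (A_+ + M) L - L (B_+ + M)
    (bracket_hamiltonian).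

    The symbol V(X) is tangent to M_n: it has no negative powers of D, and
    replacing A_+ by - A_- - A_0 and B_+ by - B_- - B_0 does not change it but
    shows that there is no power above n, while M is exactly what kills the
    coefficient of D^n (hamiltonian_tangent).  Therefore only the pairing of Y
    with tangent vectors matters, and for psi = u_(jl) the bracket is just the
    coefficient of z^l D^j in V(X).  Moreover V vanishes on symbols with
    powers of D at least 1 (hamiltonian_high) or at most - n
    (hamiltonian_low), and every symbol orthogonal to the tangent space is a
    sum of two such symbols; hence for phi = u_(ik) one may take X = D^-i z^-k.

    For this X the two products are explicit,
        A = \sum_s u_s q^((i - s) k) z^-k D^(s - i),
        B = \sum_s q^(i k) z^-k (h^-i u_s) D^(s - i),
    so that A_0 = h^i B_0 and M - P_00 A = (1 - h^(n - i)) (1 - h^n)^-1 P_0' A.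
    In the coefficient of D^j of V(X), M contributes M u_j - u_j h^j M, which
    is the first sum of the formula, and A_+ L and L B_+ contribute the two
    sums of delta functions, the summation index r being the power of D taken
    from A_+ or B_+ (hamiltonian_coef). *)

(** * Sums over the integers with finite support *)

Lemma fsbig_interval (V : nmodType) (F : int -> V) (c : int) (T : nat) :
    (forall i, (i < c) || (c + T%:Z <= i) -> F i = 0) ->
  \sum_(i \in [set: int]) F i = \sum_(i < T) F (c + i%:Z).
Proof.
move=> F0; pose I := [seq c + i%:Z | i <- iota 0 T].
rewrite -(@fsbig_widen _ _ _ _ [set` I])//; last first.
  move=> i [_ /negP iI]; apply/F0; apply: contraR iI.
  rewrite negb_or -leNgt -ltNge => /andP[ci iT].
  by apply/mapP; exists `|i - c|%N; rewrite ?mem_iota; lia.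
rewrite -fsbig_seq; last by rewrite map_inj_uniq ?iota_uniq// => i j; lia.
by rewrite big_map -[T in LHS]subn0 -/(index_iota _ _) big_mkord.
Qed.

(** * The automorphisms h^e of K((z^-1)) *)

Section LaurentScaling.
Variable K : numFieldType.
Implicit Types (a b : laurent K) (m : int).

Lemma monomialM (x : K) m a p :
  ((monomial (x : K^o) m : laurent K) * a) p = x * a (p - m) :> K.
Proof.
rewrite lcoefsM (@fsbig_interval _ _ m 1) ?big_ord_recl ?big_ord0 /=.
  by rewrite !addr0 eqxx.
by move=> i Hi; rewrite /=; case: eqP => [?|]; rewrite ?mul0r//; lia.
Qed.

(** Scaling as the product by a constant series, a form open to ring
    arguments. *)
Lemma lscaleE (x : K) a : x *: a = (monomial (x : K^o) 0 : laurent K) * a.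
Proof. by apply: seriesP => m; rewrite monomialM subr0. Qed.

Lemma lscaleAl (x : K) a b : (x *: a) * b = x *: (a * b).
Proof. by rewrite !lscaleE mulrA. Qed.

Lemma lscaleAr (x : K) a b : a * (x *: b) = x *: (a * b).
Proof. by rewrite !lscaleE mulrCA. Qed.

End LaurentScaling.

Section LaurentTheory.
Variables (K : numFieldType) (q : K).
Hypothesis q0 : q != 0.
Implicit Types (a b : laurent K) (e f m : int).

Lemma hpowE e a m : hpow q e a m = q ^ (e * m) * a m :> K.
Proof. by []. Qed.

Lemma hpow_is_zmod_morphism e : zmod_morphism (hpow q e).
Proof.
by move=> a b; apply: seriesP => m; rewrite coefsD coefsN !hpowE coefsD coefsN mulrBr.
Qed.

HB.instance Definition _ e := GRing.isZmodMorphism.Build _ _ (hpow q e)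
  (hpow_is_zmod_morphism e).

Lemma hpowD e a b : hpow q e (a + b) = hpow q e a + hpow q e b.
Proof. exact: raddfD. Qed.

Lemma hpowB e a b : hpow q e (a - b) = hpow q e a - hpow q e b.
Proof. exact: raddfB. Qed.

Lemma hpow_sum e (I : Type) (r : seq I) (P : pred I) (F : I -> laurent K) :
  hpow q e (\sum_(i <- r | P i) F i) = \sum_(i <- r | P i) hpow q e (F i).
Proof. exact: raddf_sum. Qed.

Lemma hpow1 e : hpow q e 1 = 1.
Proof.
by apply: seriesP => m; rewrite hpowE /=; case: eqP => [->|]; rewrite ?mulr0// expr0z mul1r.
Qed.

(** h^e is multiplicative since q^(e i) q^(e (m - i)) = q^(e m) in each term of
    the convolution. *)
Lemma hpowM e a b : hpow q e (a * b) = hpow q e a * hpow q e b.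
Proof.
apply: seriesP => m; rewrite hpowE !lcoefsM.
have [N Na] := series_bound a; have [M Mb] := series_bound b.
have Z i (x y : K) : (i < m - M) || (m - M + `|(N - (m - M) + 1)%R|%N%:Z <= i) ->
    x * a i * (y * b (m - i)) = 0 :> K.
  case/orP => Hi; first by rewrite (Mb (m - i)) ?mulr0//; lia.
  by rewrite Na ?(mulr0, mul0r)//; lia.
rewrite (@fsbig_interval _ _ (m - M) `|(N - (m - M) + 1)%R|%N); last first.
  by move=> i iI; rewrite -[a i]mul1r -[b _]mul1r Z.
rewrite (@fsbig_interval _ _ (m - M) `|(N - (m - M) + 1)%R|%N); last first.
  by move=> i iI; rewrite !hpowE Z.
rewrite mulr_sumr; apply: eq_bigr => i _; rewrite !hpowE.
by rewrite mulrACA -expfzDr//; congr (q ^ _ * _); lia.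
Qed.

Lemma hpow_hpow e f a : hpow q e (hpow q f a) = hpow q (e + f) a.
Proof. by apply: seriesP => m; rewrite !hpowE mulrA -expfzDr// mulrDl. Qed.

Lemma hpow0 a : hpow q 0 a = a.
Proof. by apply: seriesP => m; rewrite hpowE mul0r expr0z mul1r. Qed.

Lemma hpowZ e (x : K) a : hpow q e (x *: a) = x *: hpow q e a.
Proof.
apply: seriesP => m; transitivity (q ^ (e * m) * (x * a m) : K); first by [].
by transitivity (x * (q ^ (e * m) * a m) : K); first exact: mulrCA.
Qed.

Lemma lint_hpow e a : lint (hpow q e a) = lint a.
Proof. by rewrite /lint hpowE mulr0 expr0z mul1r. Qed.

End LaurentTheory.

(** * The associative algebra of symbols and its trace *)

Section PsidoTheory.
Variables (K : numFieldType) (q : K).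
Notation "A *D B" := (psmul q A B) (at level 40, left associativity).
Implicit Types (A B C : psido K) (u v : laurent K) (s k : int).

(** All computations with the product of symbols go through this finite form
    of its defining sum. *)
Lemma psmul_interval (c : int) (T : nat) A B k :
    (forall i, (i < c) || (c + T%:Z <= i) -> A i = 0 \/ B (k - i) = 0) ->
  (A *D B) k = \sum_(i < T) A (c + i%:Z) * hpow q (c + i%:Z) (B (k - (c + i%:Z))).
Proof.
move=> AB0; rewrite -(@fsbig_interval _ (fun i => A i * hpow q i (B (k - i))))// => i /AB0[] ->.
  by rewrite mul0r.
by rewrite raddf0 mulr0.
Qed.

Lemma psmul_bound A B (N M : int) :
  (forall i, N < i -> A i = 0) -> (forall i, M < i -> B i = 0) ->
  forall k, N + M < k -> (A *D B) k = 0.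
Proof.
move=> NA MB k NMk; rewrite (@psmul_interval 0 0) ?big_ord0// => i _.
by have [/NA|iN] := ltP N i; [left|right; apply: MB; lia].
Qed.

Lemma psmul_lower A B (N M : int) :
  (forall i, i < N -> A i = 0) -> (forall i, i < M -> B i = 0) ->
  forall k, k < N + M -> (A *D B) k = 0.
Proof.
move=> NA MB k NMk; rewrite (@psmul_interval 0 0) ?big_ord0// => i _.
by have [/NA|iN] := ltP i N; [left|right; apply: MB; lia].
Qed.

Lemma psmul_top A B (N M : int) :
  (forall i, N < i -> A i = 0) -> (forall i, M < i -> B i = 0) ->
  (A *D B) (N + M) = A N * hpow q N (B M).
Proof.
move=> NA MB; rewrite (@psmul_interval N 1) ?big_ord_recl ?big_ord0.
  by rewrite !addr0 addrC addKr.
by move=> i Hi; have [/NA|iN] := ltP N i; [left|right; apply: MB; lia].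
Qed.

(** The range depends on bounds for A and B only, so that factors with common
    bounds get sums over the same range, which can be compared termwise. *)
Lemma psmul_sum A B (N M k : int) :
  (forall i, N < i -> A i = 0) -> (forall i, M < i -> B i = 0) ->
  (A *D B) k = \sum_(i < `|(N - (k - M) + 1)%R|)
    A (k - M + i%:Z) * hpow q (k - M + i%:Z) (B (k - (k - M + i%:Z))).
Proof.
move=> NA MB; apply: psmul_interval => i /orP[] iI; [right; apply: MB|left; apply: NA]; lia.
Qed.

Lemma series_bound2 A B : exists N : int,
  (forall i, N < i -> A i = 0) /\ (forall i, N < i -> B i = 0).
Proof.
have [N NA] := series_bound A; have [M MB] := series_bound B.
exists (Num.max N M); split=> i; rewrite gt_max => /andP[Ni Mi]; [exact: NA|exact: MB].
Qed.

Lemma psmulDl A B C : (A + B) *D C = A *D C + B *D C.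
Proof.
apply: seriesP => k; rewrite coefsD.
have [N [NA NB]] := series_bound2 A B; have [P PC] := series_bound C.
have NAB i : N < i -> (A + B) i = 0 by move=> Ni; rewrite coefsD NA// NB// addr0.
rewrite !(@psmul_sum _ _ N P)// -big_split; apply: eq_bigr => i _ /=.
exact: mulrDl.
Qed.

Lemma psmulDr A B C : A *D (B + C) = A *D B + A *D C.
Proof.
apply: seriesP => k; rewrite coefsD.
have [N [NB NC]] := series_bound2 B C; have [P PA] := series_bound A.
have NBC i : N < i -> (B + C) i = 0 by move=> Ni; rewrite coefsD NB// NC// addr0.
rewrite !(@psmul_sum _ _ P N)// -big_split; apply: eq_bigr => i _ /=.
by rewrite -mulrDr -raddfD.
Qed.

Lemma psmulZl (x : K) A B : (x *: A) *D B = x *: (A *D B).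
Proof.
have [N NA] := series_bound A; have [P PB] := series_bound B.
have NxA i : N < i -> (x *: A) i = 0 by move=> Ni; rewrite coefsZ NA// scaler0.
apply: seriesP => k; rewrite coefsZ !(@psmul_sum _ _ N P)// scaler_sumr.
apply: eq_bigr => i _; rewrite coefsZ; exact: lscaleAl.
Qed.

Lemma psmulZr (x : K) A B : A *D (x *: B) = x *: (A *D B).
Proof.
have [N NA] := series_bound A; have [P PB] := series_bound B.
have PxB i : P < i -> (x *: B) i = 0 by move=> Pi; rewrite coefsZ PB// scaler0.
apply: seriesP => k; rewrite coefsZ !(@psmul_sum _ _ N P)// scaler_sumr.
by apply: eq_bigr => i _; rewrite coefsZ hpowZ; exact: lscaleAr.
Qed.

Lemma psmul_monomiall u s A k : (monomial u s *D A) k = u * hpow q s (A (k - s)).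
Proof.
rewrite (@psmul_interval s 1) ?big_ord_recl ?big_ord0 /=.
  by rewrite !addr0 eqxx.
by move=> i Hi; left; case: eqP => // ?; lia.
Qed.

Lemma psmul_monomialr A u s k : (A *D monomial u s) k = A (k - s) * hpow q (k - s) u.
Proof.
rewrite (@psmul_interval (k - s) 1) ?big_ord_recl ?big_ord0 /=.
  by rewrite !addr0 subKr eqxx.
by move=> i Hi; right; case: eqP => // ?; lia.
Qed.

Hypothesis q0 : q != 0.

(** Left multiplication by u D^s shifts the summation index of the product by
    s, and h^s is multiplicative. *)
Lemma psmul_monomialA u s B C : (monomial u s *D B) *D C = monomial u s *D (B *D C).
Proof.
apply: seriesP => k; rewrite psmul_monomiall.
have [N NB] := series_bound B; have [M MC] := series_bound C.
have NB' i : s + N < i -> (monomial u s *D B) i = 0.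
  by move=> Ni; rewrite psmul_monomiall NB ?raddf0 ?mulr0//; lia.
rewrite (psmul_sum _ NB' MC) (psmul_sum _ NB MC) hpow_sum mulr_sumr.
have -> : `|(s + N - (k - M) + 1)%R|%N = `|(N - (k - s - M) + 1)%R|%N by lia.
apply: eq_bigr => i _; rewrite psmul_monomiall hpowM// hpow_hpow// mulrA.
set c := k - s - M + i%:Z; have -> : k - M + i%:Z = s + c by rewrite /c; lia.
have -> : s + c - s = c by lia.
by have -> : k - (s + c) = k - s - c by lia.
Qed.

(** A given coefficient of either side sees only finitely many of the leading
    terms of A: once the leading power is low enough, both sides vanish by
    the degree bound.  Peeling off the leading terms one at a time leaves the
    case where A is a monomial. *)
Lemma psmulA A B C : A *D (B *D C) = (A *D B) *D C.
Proof.
apply: seriesP => k; have [M MB] := series_bound B; have [P PC] := series_bound C.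
have [N NA] := series_bound A.
have [t tN] : exists t : nat, N + M + P - k < t%:Z.
  by exists `|(N + M + P - k + 1)%R|%N; lia.
elim: t => [|t IHt] in A N NA tN *.
  rewrite (psmul_bound NA (psmul_bound MB PC)); last lia.
  by rewrite (psmul_bound (psmul_bound NA MB) PC)//; lia.
have [A' -> NA'] : exists2 A', A = monomial (A N) N + A' &
    forall i, N - 1 < i -> A' i = 0.
  exists (A - monomial (A N) N); first by rewrite addrC subrK.
  move=> i Ni; rewrite coefsD coefsN /=; case: eqP => [->|/eqP iN]; first exact: subrr.
  by rewrite NA ?subr0//; lia.
rewrite !psmulDl psmul_monomialA !coefsD; congr (_ + _).
by apply: (IHt A' (N - 1)) => //; lia.
Qed.

Lemma series_bound_nat A : exists N : nat, forall i, N%:Z < i -> A i = 0.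
Proof. by have [N NA] := series_bound A; exists `|N|%N => i Ni; apply: NA; lia. Qed.

(** The terms A_x h^x B_(-x) and B_(-x) h^(-x) A_x have the same constant
    coefficient, as h^(-x) carries one to the other. *)
Lemma TrC A B : Tr (A *D B) = Tr (B *D A).
Proof.
have [N NA] := series_bound_nat A; have [M MB] := series_bound_nat B.
rewrite /Tr /P0 (psmul_sum _ NA MB) (psmul_sum _ MB NA).
have -> : `|(M%:Z - (0 - N%:Z) + 1)%R|%N = `|(N%:Z - (0 - M%:Z) + 1)%R|%N by lia.
have lintE (I : finType) (F : I -> laurent K) : lint (\sum_i F i) = \sum_i lint (F i).
  by apply: (big_morph (@lint K)).
rewrite !lintE (reindex_inj rev_ord_inj); apply: eq_bigr => i _.
have [x -> ->] : exists2 x, 0 - M%:Z + (rev_ord i)%:Z = x & 0 - N%:Z + i%:Z = - x.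
  by exists (0 - M%:Z + (rev_ord i)%:Z) => //=; have := ltn_ord i; lia.
rewrite !sub0r opprK -(lint_hpow q (- x)) hpowM// hpow_hpow// addNr hpow0.
by rewrite mulrC.
Qed.

Lemma TrD A B : Tr (A + B) = Tr A + Tr B.
Proof. by rewrite /Tr /P0 /lint coefsD. Qed.

Lemma TrB A B : Tr (A - B) = Tr A - Tr B.
Proof. by rewrite /Tr /P0 /lint coefsD coefsN. Qed.

Lemma psmulNl A B : (- A) *D B = - (A *D B).
Proof. by rewrite -scaleN1r psmulZl scaleN1r. Qed.

Lemma psmulNr A B : A *D (- B) = - (A *D B).
Proof. by rewrite -scaleN1r psmulZr scaleN1r. Qed.

Lemma psmulBl A B C : (A - B) *D C = A *D C - B *D C.
Proof. by rewrite psmulDl psmulNl. Qed.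

Lemma psmulBr A B C : A *D (B - C) = A *D B - A *D C.
Proof. by rewrite psmulDr psmulNr. Qed.

End PsidoTheory.

(** * The Hamiltonian vector of the bracket *)

Section Hamiltonian.
Variables (K : numFieldType) (q : K) (n : nat).
Hypothesis q0 : q != 0.
Hypothesis qn : forall m : int, m != 0 -> q ^ (n%:Z * m) != 1.
Notation "A *D B" := (psmul q A B) (at level 40, left associativity).
Notation h := (hpow q n%:Z).
Implicit Types (A B X Y L : psido K) (a b u : laurent K).

Lemma half_double (V : lmodType K) (x : V) : 2^-1 *: (x + x) = x.
Proof.
have -> : x + x = (2 : K) *: x by rewrite scaler_nat.
by rewrite scalerA mulVf ?scale1r// pnatr_eq0.
Qed.

Lemma P0E A : P0 A = P0' A + P00 A.
Proof. by rewrite /P0' subrK. Qed.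

Lemma lint_P0' A : lint (P0' A) = 0.
Proof.
rewrite /P0' /P00 /lint coefsD coefsN.
transitivity (P0 A 0 - Tr A * 1 : K); first by [].
by rewrite mulr1 subrr.
Qed.

(** The series M by which both entries of the matrix applied to (A, B) differ
    from the positive parts, up to the halves of A and B. *)
Definition diagonal_term A B : laurent K :=
  hinv q n%:Z (P0' A) - h (hinv q n%:Z (P0' B)) + 2^-1 *: (P00 A + P00 B).

Lemma coef_of_laurent u k : of_laurent u k = if k == 0 then u else 0.
Proof. by []. Qed.
Lemma coef_Ppos A k : Ppos A k = if 0 < k then A k else 0.
Proof. by []. Qed.
Lemma coef_Pneg A k : Pneg A k = if k < 0 then A k else 0.
Proof. by []. Qed.

Lemma coef_nonneg_lt0 A u k : k < 0 -> (Ppos A + of_laurent u) k = 0.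
Proof.
move=> k0; rewrite coefsD coef_Ppos coef_of_laurent.
by rewrite ltNge (ltW k0) lt_eqF// addr0.
Qed.

Lemma coef_nonneg_gt0 A u k : 0 < k -> (Ppos A + of_laurent u) k = A k.
Proof.
by move=> k0; rewrite coefsD coef_Ppos coef_of_laurent k0 gt_eqF// addr0.
Qed.

Lemma coef_nonneg_0 A u : (Ppos A + of_laurent u) 0 = u.
Proof. by rewrite coefsD coef_Ppos coef_of_laurent ltxx add0r. Qed.

Lemma psido_split A : A = Ppos A + of_laurent (P0 A) + Pneg A.
Proof.
apply: seriesP => k; rewrite !coefsD coef_Ppos coef_Pneg coef_of_laurent.
by case: ltgtP => [||<-]; rewrite ?addr0 ?add0r.
Qed.

Lemma of_laurent_is_zmod_morphism : zmod_morphism (@of_laurent K).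
Proof.
move=> a b; apply: seriesP => k.
by rewrite coefsD coefsN !coef_of_laurent; case: ifP; rewrite // subr0.
Qed.
HB.instance Definition _ := GRing.isZmodMorphism.Build _ _ (@of_laurent K)
  of_laurent_is_zmod_morphism.

Lemma of_laurentD a b : of_laurent (a + b) = of_laurent a + of_laurent b.
Proof. exact: raddfD. Qed.

Lemma of_laurentB a b : of_laurent (a - b) = of_laurent a - of_laurent b.
Proof. exact: raddfB. Qed.

Lemma of_laurentZ (x : K) a : of_laurent (x *: a) = x *: of_laurent a.
Proof.
apply: seriesP => k.
by rewrite coefsZ !coef_of_laurent; case: ifP; rewrite // scaler0.
Qed.

(** Eliminating P_- by P_- = 1 - P_+ - P_0 leaves a multiple of the identity,
    whose contribution to the bracket is zero. *)
Lemma ropE A : rop A = Ppos A + of_laurent (2^-1 *: P0 A) - 2^-1 *: A.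
Proof.
rewrite {4}(psido_split A) /rop of_laurentZ -[X in X + _ - _]half_double.
rewrite -scalerDr -scalerBr. congr (_ *: _).
by rewrite !opprD !addrA; congr (_ - _); rewrite addrAC addrK addrK.
Qed.

Lemma P0_hinv A :
  P0 A = hinv q n%:Z (P0' A) - h (hinv q n%:Z (P0' A)) + P00 A.
Proof. by rewrite hinvK ?lint_P0'// -P0E. Qed.

(** Both rows of the matrix yield the same diagonal term; for the first row
    (1 + h) / (1 - h) / 2 + 1 / 2 = 1 / (1 - h), and for the second
    1 / 2 - (1 + h) / (1 - h) / 2 = - h / (1 - h), with h standing for h^n. *)
Lemma Rmatrix_split A B :
  Rmatrix q n%:Z (A, B) =
    (Ppos A + of_laurent (diagonal_term A B) - 2^-1 *: A,
     Ppos B + of_laurent (diagonal_term A B) - 2^-1 *: B).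
Proof.
(* multiplication by 1/2 + 1/2, in the form that ring understands *)
have c1 (x : laurent K) :
    (monomial (2^-1 : K^o) 0 + monomial (2^-1 : K^o) 0 : laurent K) * x = x.
  by rewrite mulrDl -!lscaleE -scalerDr half_double.
have first_row (x x' z a0 b0 : laurent K) :
    2^-1 *: (x - x' + a0) + 2^-1 *: (x + x') + (- z + 2^-1 *: b0) =
    x - z + 2^-1 *: (a0 + b0).
  by rewrite !lscaleE -[X in _ = X - _ + _]c1; ring.
have second_row (y z x a0 b0 : laurent K) :
    x + 2^-1 *: a0 + 2^-1 *: (y - z + b0) - 2^-1 *: (y + z) =
    x - z + 2^-1 *: (a0 + b0).
  by rewrite !lscaleE -[X in _ = _ - X + _]c1; ring.
have sum_first (P Z : psido K) x y z :
    P + of_laurent x - Z + of_laurent y + of_laurent z =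
    P + of_laurent (x + y + z) - Z.
  by rewrite !of_laurentD !addrA [LHS](ACl (1*2*4*5*3)).
have sum_second (P Z : psido K) x y z :
    of_laurent z + (P + of_laurent x - Z - of_laurent y) =
    P + of_laurent (z + x - y) - Z.
  by rewrite of_laurentB of_laurentD !addrA [LHS](ACl (2*1*3*5*4)).
by rewrite /Rmatrix /= !ropE sum_first sum_second !P0_hinv first_row second_row.
Qed.

(** The vector V(X) with {phi, psi} = < V(X), d psi > whenever X = d phi. *)
Definition hamiltonian L X : psido K :=
  let M := of_laurent (diagonal_term (L *D X) (X *D L)) in
  (Ppos (L *D X) + M) *D L - L *D (Ppos (X *D L) + M).

(** Invariance of the trace moves L from (L Y, Y L) to the other factor; the
    contribution of A / 2 and B / 2 is then (A L - L B) / 2, which is 0 for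
    A = L X and B = X L. *)
Lemma bracket_hamiltonian L X Y :
  bracket_of_gradients q n L X Y = pairing q (hamiltonian L X) Y.
Proof.
rewrite /bracket_of_gradients Rmatrix_split /dpairing /pairing /=.
set P := Ppos (L *D X) + _; set Q := Ppos (X *D L) + _.
set A := L *D X; set B := X *D L.
have half_comm : (2^-1 *: A) *D L = L *D (2^-1 *: B).
  by rewrite psmulZl// psmulZr// psmulA.
have -> : hamiltonian L X = (P - 2^-1 *: A) *D L - L *D (Q - 2^-1 *: B).
  by rewrite psmulBl// psmulBr// half_comm opprB addrA subrK.
move: (P - _) (Q - _) => P' Q'.
rewrite psmulBl// [Tr (_ - _)]TrB psmulA//; congr (_ - _).
by rewrite psmulA// TrC// psmulA.
Qed.

Lemma psmul_of_laurentl u A k : (of_laurent u *D A) k = u * A k.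
Proof. by rewrite psmul_monomiall// hpow0 subr0. Qed.

Lemma psmul_of_laurentr A u k : (A *D of_laurent u) k = A k * hpow q k u.
Proof. by rewrite psmul_monomialr// subr0. Qed.

Lemma hinvD a b : hinv q n%:Z (a + b) = hinv q n%:Z a + hinv q n%:Z b.
Proof.
apply: seriesP => m; rewrite coefsD /=; case: ifP => [_|_]; first by rewrite addr0.
exact: mulrDr.
Qed.

Lemma hpow_hinv e a : hpow q e (hinv q n%:Z a) = hinv q n%:Z (hpow q e a).
Proof.
by apply: seriesP => m; rewrite hpowE /=; case: ifP; rewrite ?mulr0// mulrCA.
Qed.

Lemma P00D A B : P00 (A + B) = P00 A + P00 B.
Proof. by rewrite /P00 TrD scalerDl. Qed.

Lemma P0'D A B : P0' (A + B) = P0' A + P0' B.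
Proof. by rewrite /P0' P00D opprD addrACA. Qed.

Lemma diagonal_termD A1 A2 B1 B2 :
  diagonal_term (A1 + A2) (B1 + B2) = diagonal_term A1 B1 + diagonal_term A2 B2.
Proof.
rewrite /diagonal_term !P0'D !P00D.
rewrite ![hinv _ _ (P0' _ + P0' _)]hinvD hpowD opprD !scalerDr.
by rewrite !addrA [LHS](ACl (1*3*5*7*2*4*6*8)).
Qed.

Lemma PposD A B : Ppos (A + B) = Ppos A + Ppos B.
Proof.
apply: seriesP => k; rewrite coefsD !coef_Ppos coefsD.
by case: ifP; rewrite ?addr0.
Qed.

Lemma hamiltonianD L X Y : hamiltonian L (X + Y) = hamiltonian L X + hamiltonian L Y.
Proof.
rewrite /hamiltonian [L *D (X + Y)]psmulDr// [(X + Y) *D L]psmulDl//.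
rewrite !PposD diagonal_termD of_laurentD.
rewrite [X in X *D L - _]addrACA [X in _ - L *D X]addrACA.
by rewrite [in X in X - _]psmulDl// [in X in _ - X]psmulDr// opprD addrACA.
Qed.



Section AtL.
Variable L : psido K.
Hypothesis LM : is_Mn n L.

Lemma Mn_top : L n%:Z = 1. Proof. by case: LM. Qed.
Lemma Mn_above i : n%:Z < i -> L i = 0.
Proof. by case: LM => _ L0 ni; apply: L0; right. Qed.
Lemma Mn_below i : i < 0 -> L i = 0.
Proof. by case: LM => _ L0 ni; apply: L0; left. Qed.

Lemma P00_comm X : P00 (X *D L) = P00 (L *D X).
Proof. by rewrite /P00 TrC. Qed.

Lemma hpow_P00 e A : hpow q e (P00 A) = P00 A.
Proof. by rewrite /P00 hpowZ hpow1. Qed.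

(** Then L X and X L equal their positive parts and M = 0, so that
    associativity leaves (L X) L - L (X L) = 0. *)
Lemma hamiltonian_high X : (forall i, i < 1 -> X i = 0) -> hamiltonian L X = 0.
Proof.
move=> X0.
have LX k : k < 1 -> (L *D X) k = 0.
  by move=> k1; rewrite (psmul_lower q Mn_below X0)//; lia.
have XL k : k < 1 -> (X *D L) k = 0.
  by move=> k1; rewrite (psmul_lower q X0 Mn_below)//; lia.
have M0 : diagonal_term (L *D X) (X *D L) = 0.
  have hinv0 : hinv q n%:Z 0 = 0.
    by apply: seriesP => m /=; case: ifP; rewrite // mulr0.
  by rewrite /diagonal_term /P0' /P00 /Tr /P0 LX// XL// scale0r subrr
    hinv0 raddf0 subrr addr0 scaler0 addr0.
have PE A : (forall k, k < 1 -> A k = 0) -> Ppos A = A.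
  move=> A0; apply: seriesP => k; rewrite coef_Ppos.
  by case: ltP => // k0; rewrite A0//; lia.
by rewrite /hamiltonian M0 raddf0 !addr0 !PE// psmulA// subrr.
Qed.

(** Then L X and X L have no positive part and P_0 (L X) = h^n P_0 (X L), so
    that M reduces to a scalar, which commutes with L. *)
Lemma hamiltonian_low X : (forall i, - n%:Z < i -> X i = 0) -> hamiltonian L X = 0.
Proof.
move=> X0.
have LX k : 0 < k -> (L *D X) k = 0.
  by move=> k0; rewrite (psmul_bound q Mn_above X0)//; lia.
have XL k : 0 < k -> (X *D L) k = 0.
  by move=> k0; rewrite (psmul_bound q X0 Mn_above)//; lia.
have XL0 : P0 (X *D L) = X (- n%:Z).
  by have := psmul_top q X0 Mn_above; rewrite addNr Mn_top hpow1 mulr1.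
have LX0 : P0 (L *D X) = h (P0 (X *D L)).
  by have := psmul_top q Mn_above X0; rewrite subrr Mn_top mul1r XL0.
have PE A : (forall k, 0 < k -> A k = 0) -> Ppos A = 0.
  by move=> A0; apply: seriesP => k; rewrite coef_Ppos; case: ltP => // /A0.
have ME : diagonal_term (L *D X) (X *D L) = P00 (L *D X).
  rewrite /diagonal_term hpow_hinv /P0' LX0 hpowB hpow_P00 P00_comm subrr add0r.
  exact: half_double.
rewrite /hamiltonian ME !PE// !add0r; apply: seriesP => k.
by rewrite coefsD coefsN psmul_of_laurentl psmul_of_laurentr hpow_P00 mulrC subrr.
Qed.

(** The two bounds come from two expressions of V(X): one with A_+ and B_+,
    and one with - A_- - A_0 and - B_- - B_0, equal because A L = L B.  In the
    second the coefficient of D^n is (M - A_0) - h^n (M - B_0), and M was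
    made for this to vanish. *)
Lemma hamiltonian_tangent X : tangent_Mn n (hamiltonian L X).
Proof.
move=> k [k0|nk].
  rewrite /hamiltonian coefsD coefsN.
  rewrite (psmul_lower q (@coef_nonneg_lt0 _ _) Mn_below)//.
  by rewrite (psmul_lower q Mn_below (@coef_nonneg_lt0 _ _))// subrr.
set A := L *D X; set B := X *D L; set M := diagonal_term A B.
have PE C : Ppos C + of_laurent M = C + (of_laurent (M - P0 C) - Pneg C).
  rewrite {2}(psido_split C) of_laurentB !addrA [RHS](ACl (1*4*(2*5)*(3*6))).
  by rewrite /= !subrr !addr0.
have -> : hamiltonian L X = (of_laurent (M - P0 A) - Pneg A) *D L
    - L *D (of_laurent (M - P0 B) - Pneg B).
  rewrite /hamiltonian -/A -/B -/M !PE [X in X - _]psmulDl// [X in _ - X]psmulDr//.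
  by rewrite psmulA// opprD addrACA subrr add0r.
have upper C u : forall i, 0 < i -> (of_laurent u - Pneg C) i = 0.
  move=> i i0; rewrite coefsD coefsN coef_Pneg coef_of_laurent.
  by case: ltP => [?|_]; [lia | case: eqP => [?|_]; [lia | rewrite subr0]].
have zero C u : (of_laurent u - Pneg C) 0 = u.
  by rewrite coefsD coefsN coef_Pneg coef_of_laurent ltxx subr0.
rewrite coefsD coefsN; case: (eqVneq k n%:Z) => [->|kn]; last first.
  rewrite (psmul_bound q (upper _ _) Mn_above); last lia.
  by rewrite (psmul_bound q Mn_above (upper _ _)) ?subrr//; lia.
have -> : ((of_laurent (M - P0 A) - Pneg A) *D L) n%:Z = M - P0 A.
  have := psmul_top q (upper A (M - P0 A)) Mn_above.
  by rewrite add0r zero Mn_top hpow1 mulr1.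
have -> : (L *D (of_laurent (M - P0 B) - Pneg B)) n%:Z = h (M - P0 B).
  have := psmul_top q Mn_above (upper B (M - P0 B)).
  by rewrite addr0 zero Mn_top mul1r.
have ME : M = hinv q n%:Z (P0' A) - h (hinv q n%:Z (P0' B)) + P00 A.
  by rewrite /M /diagonal_term [P00 B]P00_comm half_double.
have -> : M - P0 A = h (hinv q n%:Z (P0' A)) - h (hinv q n%:Z (P0' B)).
  rewrite ME (P0_hinv A); move: (hinv _ _ _) (h _) (h _) (P00 _) => x y z p; ring.
have -> : M - P0 B = hinv q n%:Z (P0' A) - hinv q n%:Z (P0' B).
  rewrite ME (P0_hinv B) [P00 B]P00_comm.
  move: (hinv _ _ (P0' A)) (hinv _ _ (P0' B)) (h _) (P00 _) => x y z p; ring.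
by rewrite hpowB subrr.
Qed.

End AtL.

End Hamiltonian.

(** * Gradients of the coefficient functionals *)

Section Gradients.
Variables (K : numFieldType) (q : K) (n : nat).
Implicit Types (X G : psido K).

Lemma is_derive_affine (a b x : K) : is_derive x (1 : K) (fun t : K => a + t * b) b.
Proof.
have := is_deriveD (is_derive_cst a x (1 : K))
  (is_deriveM (is_derive_id x (1 : K)) (is_derive_cst b x 1)).
move=> H; apply: is_derive_eq H _.
by rewrite scaler0 !add0r /GRing.scale /= mulr1.
Qed.

(** u_(ik) is linear, hence equal to its own derivative. *)
Lemma is_gradient_ucoef (i : nat) (k : int) L G :
  is_gradient q n (ucoef i k) L G <->
  forall X, tangent_Mn n X -> pairing q G X = X i%:Z k.
Proof.
have dX X : is_derive (0 : K) 1 (fun t : K => ucoef i k (L + t *: X)) (X i%:Z k).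
  have -> : (fun t : K => ucoef i k (L + t *: X)) = fun t => L i%:Z k + t * X i%:Z k.
    by apply/funext => t; rewrite /ucoef coefsD coefsZ.
  exact: is_derive_affine.
split=> [gG X tX|gG X tX]; last by rewrite gG.
have [_ <-] := dX X; by have [_ ->] := gG X tX.
Qed.

Hypothesis q0 : q != 0.

(** The symbol D^-i z^-k. *)
Definition coef_gradient (i k : int) : psido K :=
  monomial (monomial (q ^ (i * k) : K^o) (- k) : laurent K) (- i).

Lemma pairing_coef_gradient i k X : pairing q (coef_gradient i k) X = X i k.
Proof.
rewrite /pairing /Tr /P0 /lint psmul_monomiall monomialM hpowE !opprK !add0r.
by rewrite mulrA -expfzDr// mulNr subrr expr0z mul1r.
Qed.

(** Testing against the monomials z^p D^e with 0 <= e < n leaves only the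
    powers of D outside ]-n, 0], which is how far two gradients of the same
    functional may differ. *)
Lemma tangent_orthogonal G : (forall X, tangent_Mn n X -> pairing q G X = 0) ->
  forall i : int, - n%:Z < i <= 0 -> G i = 0.
Proof.
move=> G0 i /andP[ni i0]; apply: seriesP => m.
have /G0 : tangent_Mn n (monomial (monomial (1 : K^o) (- m) : laurent K) (- i)).
  by move=> e en /=; case: eqP => // ?; lia.
rewrite /pairing TrC// /Tr /P0 /lint psmul_monomiall monomialM hpowE !opprK !add0r mul1r.
by move/eqP; rewrite mulf_eq0 expfz_eq0 (negPf q0) andbF => /eqP.
Qed.

End Gradients.

(** * The coefficients of the Hamiltonian vector *)

Section Coefficients.
Variables (K : numFieldType) (q : K).
Implicit Types (P Q : psido K).
Notation "A *D B" := (psmul q A B) (at level 40, left associativity).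

(** Here and in the next lemma the sum is indexed by the power of D taken from
    the factor without negative powers, as in the sums of delta functions. *)
Lemma psmul_nonneg_left P Q (j : int) (T : nat) : (forall i, i < 0 -> P i = 0) ->
    (forall i, T%:Z < i -> P i = 0 \/ Q (j - i) = 0) ->
  (P *D Q) j = \sum_(0 <= r < T.+1) P r%:Z * hpow q r%:Z (Q (j - r%:Z)).
Proof.
move=> P0 PQ0; rewrite (@psmul_interval _ _ 0 T.+1) ?big_mkord.
  by apply: eq_bigr => r _; rewrite add0r.
by move=> i /orP[/P0|Ti]; [left|apply: PQ0; lia].
Qed.

Lemma psmul_nonneg_right P Q (j : int) (T : nat) : (forall i, i < 0 -> Q i = 0) ->
    (forall i, T%:Z < i -> P (j - i) = 0 \/ Q i = 0) ->
  (P *D Q) j = \sum_(0 <= r < T.+1) P (j - r%:Z) * hpow q (j - r%:Z) (Q r%:Z).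
Proof.
move=> Q0 PQ0; rewrite (@psmul_interval _ _ (j - T%:Z) T.+1) ?big_mkord.
  rewrite (reindex_inj rev_ord_inj); apply: eq_bigr => r _.
  have -> : j - T%:Z + (rev_ord r)%:Z = j - r%:Z by have := ltn_ord r; rewrite /=; lia.
  by rewrite subKr.
move=> i /orP[iT|Ti]; first by have := PQ0 (j - i); rewrite subKr; apply; lia.
by right; apply: Q0; lia.
Qed.

Lemma coef_sum (I : Type) (r : seq I) (F : I -> laurent K) m :
  (\sum_(i <- r) F i) m = \sum_(i <- r) F i m :> K.
Proof. exact: (big_morph (fun a : laurent K => a m : K)). Qed.
End Coefficients.

Section FrenkelReshetikhin.
Variables (K : numFieldType) (q : K) (n : nat).
Hypothesis q0 : q != 0.
Variable L : psido K.
Hypothesis LM : is_Mn n L.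
Variables (i j : nat) (k l : int).
Hypotheses (ni : (i < n)%N) (nj : (j < n)%N).
Notation "A *D B" := (psmul q A B) (at level 40, left associativity).
Let G := coef_gradient q i%:Z k.

Lemma L_mul_gradient (r p : int) :
  (L *D G) r p = q ^ (- (r * k)) * L (r + i%:Z) (p + k) :> K.
Proof.
rewrite psmul_monomialr opprK mulrC.
have -> : hpow q (r + i%:Z) (monomial (q ^ (i%:Z * k) : K^o) (- k)) =
    monomial (q ^ (- (r * k)) : K^o) (- k) :> laurent K.
  apply: seriesP => m; rewrite hpowE /=; case: eqP => [->|]; rewrite ?mulr0//.
  by rewrite -expfzDr//; congr (q ^ _); ring.
by rewrite monomialM opprK.
Qed.

Lemma gradient_mul_L (r p : int) :
  (G *D L) r p = q ^ (- (i%:Z * p)) * L (r + i%:Z) (p + k) :> K.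
Proof.
rewrite psmul_monomiall opprK monomialM hpowE opprK mulrA -expfzDr//.
by congr (q ^ _ * _); ring.
Qed.

Let M := diagonal_term q n (L *D G) (G *D L).

(** P_0 (L G) = h^i P_0 (G L) for the gradient G of u_(ik), whence
    M - P_00 (L G) = (1 - h^(n - i)) (1 - h^n)^-1 P_0' (L G). *)
Lemma diagonal_term_gradient (p : int) : p != 0 ->
  M p = (1 - q ^ (p * (n%:Z - i%:Z))) / (1 - q ^ (p * n%:Z)) * L i%:Z (k + p) :> K.
Proof.
move=> p0.
have P00p A : P00 A p = 0 :> K.
  transitivity (Tr A * (if p == 0 then 1 else 0) : K); first by [].
  by rewrite (negPf p0) mulr0.
have P0'E A : P0' A p = A 0 p :> K.
  transitivity (A 0 p - P00 A p : K); first by [].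
  by rewrite P00p subr0.
transitivity (hinv q n%:Z (P0' (L *D G)) p - hpow q n%:Z (hinv q n%:Z (P0' (G *D L))) p
   + 2^-1 * (P00 (L *D G) p + P00 (G *D L) p) : K); first by [].
have hinvE b : hinv q n%:Z b p = (1 - q ^ (n%:Z * p))^-1 * b p :> K.
  by rewrite /= (negPf p0).
rewrite !P00p addr0 mulr0 addr0 hpowE !hinvE !P0'E L_mul_gradient gradient_mul_L.
rewrite !add0r mul0r oppr0 expr0z mul1r (addrC p k) (mulrC p n%:Z).
have -> : p * (n%:Z - i%:Z) = n%:Z * p + - (i%:Z * p) by ring.
by rewrite expfzDr//; ring.
Qed.

(** In V(G) the diagonal term contributes M u_j - u_j h^j M, and the
    positive parts contribute, for each power D^r taken from them, one product
    of u_(i + r) and u_(j - r); no power beyond n - i or beyond j occurs, which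
    gives the range of r. *)
Lemma hamiltonian_coef : (hamiltonian q n L G) j%:Z l = FR_series q n L i j k l.
Proof.
rewrite /FR_series; set T := minn (n - i) j.
have delta_G r p : (1 <= r < T.+1)%N ->
   ((L *D G) r%:Z * hpow q r%:Z (L (j%:Z - r%:Z))) p =
   delta_mul (q ^ r%:Z) (lprod (L (j - r)%N%:Z) (L (i + r)%N%:Z)) k p :> K.
  move=> /andP[_ rT].
  have rj : (r <= j)%N by rewrite -ltnS (leq_trans rT)// ltnS geq_minr.
  have -> : j%:Z - r%:Z = (j - r)%N by lia.
  rewrite lcoefsM /delta_mul /wz_mul /lprod.
  (* the index m of the delta function against the index of the convolution *)
  have inv : involutive (fun m : int => p - k - m) by move=> m; ring.
  rewrite (@reindex_fsbigT _ _ _ int int _ _ (inv_bij inv)); apply: eq_fsbigr => m _.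
  rewrite L_mul_gradient hpowE.
  have -> : p - k - m + k = p - m by ring.
  have -> : p - (p - k - m) = k + m by ring.
  have -> : r%:Z + i%:Z = (i + r)%N by lia.
  rewrite exprz_exp mulrACA -expfzDr// [L _ _ * _]mulrC; congr (q ^ _ * _); ring.
have delta_G' r p : (1 <= r < T.+1)%N ->
   (L (j%:Z - r%:Z) * hpow q (j%:Z - r%:Z) ((G *D L) r%:Z)) p =
   delta_mul (q ^ (i%:Z - j%:Z + r%:Z))^-1
          (lprod (L (i + r)%N%:Z) (L (j - r)%N%:Z)) k p :> K.
  move=> /andP[_ rT].
  have rj : (r <= j)%N by rewrite -ltnS (leq_trans rT)// ltnS geq_minr.
  rewrite lcoefsM /delta_mul /wz_mul /lprod.
  have inv : involutive (fun m : int => p - m) by move=> m; ring.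
  rewrite (@reindex_fsbigT _ _ _ int int _ _ (inv_bij inv)); apply: eq_fsbigr => m _.
  rewrite hpowE gradient_mul_L subKr [m + k]addrC.
  have -> : r%:Z + i%:Z = (i + r)%N by lia.
  rewrite [in RHS](_ : (j - r)%N%:Z = j%:Z - r%:Z); last by lia.
  rewrite invr_expz exprz_exp mulrA -expfzDr// mulrCA [L _ _ * _]mulrC.
  congr (q ^ _ * _); ring.
have diag p : (M * L j%:Z - L j%:Z * hpow q j%:Z M) p =
   wz_mul (fun m => if m == 0 then 0 else
        (1 - q ^ (m * (n%:Z - i%:Z))) * (1 - q ^ (m * j%:Z))
          / (1 - q ^ (m * n%:Z)))
      (lprod (L i%:Z) (L j%:Z)) k p :> K.
  rewrite [L _ * _]mulrC -mulrBl lcoefsM /wz_mul /lprod; apply: eq_fsbigr => m _.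
  rewrite coefsD coefsN hpowE; case: eqP => [->|/eqP m0].
    by rewrite mulr0 expr0z mul1r subrr !mul0r.
  rewrite diagonal_term_gradient// [j%:Z * m]mulrC.
  ring.
(* the two reasons for which the range of r is bounded by T *)
have big e : T%:Z < e -> n%:Z < e + i%:Z \/ j%:Z - e < 0.
  move=> Te; have [ni'|] := ltP (n%:Z - i%:Z) e; [left; lia|right].
  by move: Te; rewrite /T /minn; case: ifP; lia.
have left_part : ((Ppos (L *D G) + of_laurent M) *D L) j%:Z =
    M * L j%:Z + \sum_(1 <= r < T.+1) (L *D G) r%:Z * hpow q r%:Z (L (j%:Z - r%:Z)).
  rewrite (@psmul_nonneg_left _ _ _ _ _ T (@coef_nonneg_lt0 _ _ _))// => [|e Te].
    rewrite big_nat_recl// big_add1 coef_nonneg_0 hpow0 subr0; congr (_ + _).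
    by apply: eq_bigr => r _; rewrite coef_nonneg_gt0.
  have [ne|je] := big e Te; [left|right; exact: (Mn_below LM)].
  rewrite coef_nonneg_gt0; last lia.
  by apply: seriesP => m; rewrite L_mul_gradient (Mn_above LM) ?mulr0//.
have right_part : (L *D (Ppos (G *D L) + of_laurent M)) j%:Z =
    L j%:Z * hpow q j%:Z M +
    \sum_(1 <= r < T.+1) L (j%:Z - r%:Z) * hpow q (j%:Z - r%:Z) ((G *D L) r%:Z).
  rewrite (@psmul_nonneg_right _ _ _ _ _ T (@coef_nonneg_lt0 _ _ _))// => [|e Te].
    rewrite big_nat_recl// big_add1 coef_nonneg_0 subr0; congr (_ + _).
    by apply: eq_bigr => r _; rewrite coef_nonneg_gt0.
  have [ne|je] := big e Te; [right|left; exact: (Mn_below LM)].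
  rewrite coef_nonneg_gt0; last lia.
  by apply: seriesP => m; rewrite gradient_mul_L (Mn_above LM) ?mulr0//.
transitivity (((Ppos (L *D G) + of_laurent M) *D L) j%:Z l -
  (L *D (Ppos (G *D L) + of_laurent M)) j%:Z l : K); first by [].
rewrite left_part right_part !coefsD !coef_sum -diag.
rewrite (eq_big_nat _ _ (fun r rT => delta_G r l rT)).
rewrite (eq_big_nat _ _ (fun r rT => delta_G' r l rT)).
by rewrite coefsD coefsN opprD addrACA addrA.
Qed.

End FrenkelReshetikhin.

(** * The bracket of two coefficients *)

Lemma expz_neq1 (K : numFieldType) (q : K) (m : int) :
  0 < `|q| -> `|q| < 1 -> m != 0 -> q ^ m != 1.
Proof.
move=> q0 q1.
have nat_case (e : nat) : (0 < e)%N -> q ^+ e != 1.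
  move=> e0; apply/eqP => /(congr1 Num.norm); rewrite normrX normr1 => qe.
  by have := exprn_ilt1 e (normr_ge0 q) q1; rewrite qe ltxx -lt0n e0.
case: m => e e0; first by apply: nat_case; lia.
by rewrite NegzE -invr_expz invr_eq1 nat_case.
Qed.

(** The formula for nonzero q such that q^(n m) is never 1 for m <> 0.  As V(X)
    is tangent, pairing it with a gradient of u_(jl) reads off a coefficient;
    and an arbitrary gradient of u_(ik) differs from D^-i z^-k by symbols on
    which V vanishes. *)
Theorem is_bracket_ucoef (K : numFieldType) (q : K) (n : nat)
    (L : psido K) (i j : 'I_n) (k l : int) :
    q != 0 -> (forall m : int, m != 0 -> q ^ (n%:Z * m) != 1) -> is_Mn n L ->
  is_bracket q n (ucoef i k) (ucoef j l) L (FR_series q n L i j k l).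
Proof.
move=> q0 qn LM.
have grad (e : nat) m : is_gradient q n (ucoef e m) L (coef_gradient q e%:Z m).
  by apply/is_gradient_ucoef => X _; exact: pairing_coef_gradient.
split; [by eexists; exact: grad|by eexists; exact: grad|].
move=> dphi dpsi /is_gradient_ucoef dphiE /is_gradient_ucoef dpsiE.
rewrite bracket_hamiltonian// /pairing TrC// -/(pairing q _ _) dpsiE;
  last exact: hamiltonian_tangent.
rewrite -(hamiltonian_coef q0 LM k l (ltn_ord i) (ltn_ord j)).
(* D is orthogonal to the tangent space, hence lives outside the powers ]-n, 0] *)
pose D := dphi - coef_gradient q i%:Z k.
have D0 e : - n%:Z < e <= 0 -> D e = 0.
  apply: (tangent_orthogonal (n := n) q0) => X tX.
  by rewrite /pairing psmulBl// TrB -!/(pairing q _ _) dphiE// pairing_coef_gradient// subrr.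
have -> : dphi = coef_gradient q i%:Z k + (part (fun e => 0 < e) D + part (fun e => e < 1) D).
  rewrite -[LHS](subrK (coef_gradient q i%:Z k)) addrC -/D; congr (_ + _).
  by apply: seriesP => e; rewrite coefsD /=;
    case: ltP => e0; case: ltP => e1; rewrite ?addr0 ?add0r//; lia.
rewrite !hamiltonianD// (_ : hamiltonian _ _ _ (part (fun e => 0 < e) D) = 0); last first.
  by apply: hamiltonian_high => // e e1; rewrite /= ltNge -ltzD1 add0r e1.
rewrite (_ : hamiltonian _ _ _ (part (fun e => e < 1) D) = 0) ?addr0//.
by apply: hamiltonian_low => // e ne; rewrite /=; case: ltP => // ?; apply: D0; lia.
Qed.

Theorem theorem2p23 (R : realType) (q : R[i]) (hq0 : 0 < `|q|) (hq1 : `|q| < 1)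
    (n : nat) (hn : (0 < n)%N) (L : psido R[i]) (hL : is_Mn n L)
    (i j : 'I_n) (k l : int) :
  is_bracket q n (ucoef i k) (ucoef j l) L (FR_series q n L i j k l).
Proof.
apply: is_bracket_ucoef => //; first by rewrite -normr_gt0.
by move=> m m0; apply: expz_neq1 => //; rewrite mulf_neq0//; lia.
Qed.
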